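(* Let $d(k)$ denote the number of positive divisors of the positive integer $k$ and $T(q)=\sum_{k=1}^\infty d(k)\,q^k$ for $|q|<1$. Then the function $$H(q)=T(q)-\frac{\log(1-q)}{\log(q)}$$ is positive and strictly increasing on $(0,1)$.
   Context: $\log$ denotes the natural logarithm. *)

(* Defs.v *)
From Stdlib Require Import Reals.
From Coquelicot Require Import Coquelicot.
From mathcomp Require prime.
Open Scope R_scope.

Definition num_divisors (k : nat) : nat := length (prime.divisors k).

(* [Series] starts at 0, hence the shift: this is the sum over k >= 1.
   [Series] is total, and is the actual sum when Rabs q < 1. *)
Definition T (q : R) : R :=
  Series (fun n : nat => INR (num_divisors (S n)) * q ^ S n).

Definition H (q : R) : R := T q - ln (1 - q) / ln q.

(* Main.v *)
Require Import Defs.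
From Stdlib Require Import Reals Lra.
From Coquelicot Require Import Coquelicot.
From mathcomp Require Import ssreflect ssrfun ssrbool eqtype ssrnat seq div prime.
Open Scope R_scope.

(* Put q = exp (- t).  The sum of the Lambert series T q = sum_(n >= 1) phi n, with
   phi x = 1 / (exp (x t) - 1), is compared with the integral of phi over [1, oo[,
   which is - ln (1 - q) / t: thus H q is the sum of the gaps between phi n and the integral
   of phi over [n, n + 1].  The gaps are positive since phi decreases; they
   increase with q since, for t1 < t2, the difference of the two functions phi still
   decreases in x, because u e^u / (e^u - 1)^2 decreases in u. *)

(** * Comparison of a series with an integral *)

(** As [F] vanishes at infinity, [- F 1] plays the part of the integral of [f] over [1, oo[. The
    mean value theorem bounds each increment [F (x + 1) - F x] by [f x], and the increments
    telescope. *)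
Lemma series_gt_primitive (f F : R -> R) (l : R) :
  (forall x, 1 <= x -> is_derive F x (f x)) ->
  (forall x y, 1 <= x < y -> f y < f x) ->
  is_lim_seq (fun n => F (INR (S n))) 0 ->
  is_series (fun n => f (INR (S n))) l ->
  0 < l + F 1.
Proof.
move=> dF decr limF sumf.
have step x : 1 <= x -> F (x + 1) - F x < f x.
  move=> x1.
  have [||c [-> [xc cx]]] := MVT_cor2 F f x (x + 1).
  - lra.
  - move=> c cx; apply/is_derive_Reals/dF; lra.
  - have := decr x c; nra.
(* Limits keep only weak inequalities, so the first gap, strictly positive, is set aside before
   passing to the limit. *)
set gap := f 1 - (F (1 + 1) - F 1).
have gap0 : 0 < gap by have := step 1; rewrite /gap; lra.
have partial n : gap + (F (INR (S (S n))) - F 1) <= sum_n (fun n => f (INR (S n))) n.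
  elim: n => [|n IHn].
    rewrite sum_O /gap (S_INR 1) /=; lra.
  rewrite sum_Sn -[plus _ _]/(Rplus _ _).
  have := step (INR (S (S n))); rewrite -S_INR => st.
  have : 1 <= INR (S (S n)) by rewrite !S_INR; have := pos_INR n; lra.
  by move/st; lra.
have lim_left : is_lim_seq (fun n => gap + (F (INR (S (S n))) - F 1)) (gap + (0 - F 1)).
  apply: is_lim_seq_plus'; first exact: is_lim_seq_const.
  apply: is_lim_seq_minus'; last exact: is_lim_seq_const.
  exact: (is_lim_seq_incr_1 (fun n => F (INR (S n))) 0).1.
have /= := is_lim_seq_le _ _ (Finite _) (Finite l) partial lim_left sumf.
lra.
Qed.

(** * The Lambert series of the divisor function *)

Lemma sum_n_divides (k N : nat) : (0 < k <= N)%N ->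
  sum_n_m (fun n => INR (dvdn n k)) 1 N = INR (num_divisors k).
Proof.
move=> /andP[k0 kN].
have -> : num_divisors k = count (fun n => dvdn n k) (iota 1 N).
  rewrite /num_divisors -size_filter; apply: perm_size; apply: uniq_perm.
  - exact: divisors_uniq.
  - by rewrite filter_uniq // iota_uniq.
  - move=> n; rewrite -dvdn_divisors // mem_filter mem_iota add1n ltnS.
    case dnk: (dvdn n k) => //=; rewrite (dvdn_gt0 k0 dnk) /=.
    by rewrite (leq_trans (dvdn_leq k0 dnk) kN).
elim: N {kN} => [|N IHN]; first by rewrite sum_n_m_zero.
rewrite sum_n_Sm; last by apply/leP.
by rewrite IHN -(addn1 N) iotaD /plus count_cat plus_INR /= addn0 add1n addn1.
Qed.

Lemma pow_S_bounds (q : R) (n : nat) : 0 < q < 1 -> 0 < q ^ S n <= q.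
Proof.
move=> q01; split; first by apply: pow_lt; lra.
have := pow_incr q 1 n; rewrite pow1 /= => h.
have := pow_lt q n; nra.
Qed.

(* The sum of q ^ (n m) over the m with n m > N. *)
Definition lambert_tail (q : R) (N n : nat) : R :=
  q ^ (n * (N %/ n).+1) / (1 - q ^ n).

(** Passing from [N] to [N.+1] removes from the tail only the term with n m = N + 1, which exists
    exactly when n divides N + 1. *)
Lemma lambert_tail_succ (q : R) (N n : nat) : 0 < q < 1 -> (0 < n)%N ->
  lambert_tail q N n = lambert_tail q N.+1 n + INR (dvdn n N.+1) * q ^ N.+1.
Proof.
move=> q01; case: n => // n _.
have qn := pow_S_bounds q n q01.
rewrite /lambert_tail divnS //.
case dnN: (dvdn n.+1 N.+1); last by rewrite add0n /=; lra.
have eN : N.+1 = (n.+1 * (N %/ n.+1).+1)%N.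
  have <- : (N.+1 %/ n.+1 = (N %/ n.+1).+1)%N by rewrite divnS // dnN.
  by rewrite mulnC divnK.
rewrite add1n -/(nat_of_bool true) [INR true]/= [X in _ = _ + 1 * q ^ X]eN.
rewrite [in RHS]mulnS (pow_add _ n.+1); field; lra.
Qed.

(** The left side sums q ^ (n m) over the pairs with n m <= N, grouped by product. Grouped by n
    instead, each n <= N gives a full geometric series less its tail. *)
Lemma lambert_partial_sum (q : R) (N : nat) : 0 < q < 1 ->
  sum_n_m (fun k => INR (num_divisors k) * q ^ k) 1 N =
  sum_n_m (fun n => q ^ n / (1 - q ^ n)) 1 N - sum_n_m (lambert_tail q N) 1 N.
Proof.
move=> q01; elim: N => [|N IHN].
  by rewrite !sum_n_m_zero // /zero /=; lra.
rewrite !(sum_n_Sm _ 1 N); try by apply/leP.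
rewrite -(sum_n_Sm (lambert_tail q N.+1)); last by apply/leP.
have tailE : sum_n_m (lambert_tail q N) 1 N.+1 =
    sum_n_m (lambert_tail q N.+1) 1 N.+1 + INR (num_divisors N.+1) * q ^ N.+1.
  rewrite -(sum_n_divides N.+1 N.+1) ?leqnn //.
  have -> : sum_n_m (fun n => INR (dvdn n N.+1)) 1 N.+1 * q ^ N.+1 =
      sum_n_m (fun n => INR (dvdn n N.+1) * q ^ N.+1) 1 N.+1.
    by rewrite (sum_n_m_mult_r (q ^ N.+1 : R_Ring)).
  etransitivity; last exact: sum_n_m_plus.
  by apply: sum_n_m_ext_loc => n [/leP n0 _]; apply: lambert_tail_succ.
(* For n = N + 1 the quotient [N %/ n] is 0: the tail is the whole geometric series and cancels the
   new Lambert term. *)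
move: tailE; rewrite sum_n_Sm; last by apply/leP.
rewrite {2}/lambert_tail divn_small // muln1 IHN /plus /=; lra.
Qed.

(** The exponent n (N / n + 1) exceeds N and 1 - q ^ n >= 1 - q, so each of the N tails is at most q
    ^ N / (1 - q). *)
Lemma lambert_tail_sum_bounds (q : R) (N : nat) : 0 < q < 1 ->
  0 <= sum_n_m (lambert_tail q N) 1 N <= INR N * (q ^ N / (1 - q)).
Proof.
move=> q01.
have bound n : (0 < n)%N -> 0 <= lambert_tail q N n <= q ^ N / (1 - q).
  move=> n0; have ltN : (N < n * (N %/ n).+1)%N by rewrite mulnC ltn_ceil.
  have qn : 0 < q ^ n <= q by case: n n0 {ltN} => // n _; apply: pow_S_bounds.
  have le_pow : q ^ (n * (N %/ n).+1) <= q ^ N.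
    rewrite -(subnKC (ltnW ltN)) pow_add.
    have := pow_incr q 1 (n * (N %/ n).+1 - N); rewrite pow1.
    have := pow_lt q N; nra.
  have p0 : 0 < q ^ (n * (N %/ n).+1) by apply: pow_lt; lra.
  split; first by apply: Rdiv_le_0_compat; [exact: Rlt_le | lra].
  apply: Rmult_le_compat; try lra.
    apply/Rlt_le/Rinv_0_lt_compat; lra.
  apply: Rinv_le_contravar; lra.
(* The [N] inside the tails must stay fixed while the number of terms varies in the induction. *)
move: (lambert_tail q N) (q ^ N / (1 - q)) bound => tail c bound.
elim: N => [|M IHM]; first by rewrite sum_n_m_zero // /zero /=; lra.
rewrite sum_n_Sm; last by apply/leP.
rewrite -[plus _ _]/(Rplus _ _) S_INR; have := bound M.+1 isT; lra.
Qed.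

(** The ratio test makes the series of these terms converge; it needs nonzero terms, hence the shift
    past n = 0. *)
Lemma is_lim_seq_INR_mult_pow (q : R) : 0 < q < 1 ->
  is_lim_seq (fun n => INR n * q ^ n) 0.
Proof.
move=> q01.
have pos n : 0 < INR (S n) * q ^ S n.
  by apply: Rmult_lt_0_compat; [exact: lt_0_INR (Nat.lt_0_succ n) | apply: pow_lt; lra].
apply/is_lim_seq_incr_1/ex_series_lim_0.
apply: ex_series_Rabs; apply: (ex_series_DAlembert _ q); first lra.
  by move=> n; have := pos n; lra.
apply: (is_lim_seq_ext (fun n => q * (1 + / INR (S n)))).
  move=> n; rewrite Rabs_pos_eq; last exact/Rlt_le/Rdiv_lt_0_compat.
  rewrite (S_INR (S n)) -!tech_pow_Rmult.
  have : 0 < INR (S n) by exact: lt_0_INR (Nat.lt_0_succ n).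
  have h : 0 < q ^ n by apply: pow_lt; lra.
  by move=> ?; field; lra.
rewrite -[X in is_lim_seq _ X](_ : Finite (q * (1 + 0)) = _); last by congr Finite; lra.
apply: is_lim_seq_mult'; first exact: is_lim_seq_const.
apply: is_lim_seq_plus'; first exact: is_lim_seq_const.
apply: (is_lim_seq_incr_1 (fun n => / INR n) 0).1.
exact: (is_lim_seq_inv _ p_infty) is_lim_seq_INR _.
Qed.

Lemma is_series_lambert (q : R) : 0 < q < 1 ->
  is_series (fun n => q ^ S n / (1 - q ^ S n)) (T q).
Proof.
move=> q01.
(* Domination by a geometric series gives some sum [l]; it is then identified with [T q] by showing
   that the partial sums of the two series differ by tails that tend to 0. *)
have [l suml] : ex_series (fun n => q ^ S n / (1 - q ^ S n)).
  apply: (ex_series_le _ (fun n => q ^ n * / (1 - q))).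
    move=> n; have qn := pow_S_bounds q n q01.
    rewrite /norm /= /abs /= Rabs_pos_eq; last by apply: Rdiv_le_0_compat; simpl in qn; lra.
    apply: Rmult_le_compat.
    - simpl in qn; lra.
    - apply/Rlt_le/Rinv_0_lt_compat; simpl in qn; lra.
    - have := pow_lt q n; nra.
    - apply: Rinv_le_contravar; simpl in qn; lra.
  apply: ex_series_scal_r; apply: ex_series_geom; rewrite Rabs_pos_eq; lra.
suff sumT : is_series (fun n => INR (num_divisors (S n)) * q ^ S n) l.
  by rewrite /T (is_series_unique _ _ sumT).
have lim_tail : is_lim_seq (fun N => sum_n_m (lambert_tail q (S N)) 1 (S N)) 0.
  apply: (is_lim_seq_le_le (fun=> 0) _ (fun N => INR (S N) * q ^ S N * / (1 - q))).
  - move=> N; have := lambert_tail_sum_bounds q (S N) q01; rewrite /Rdiv; lra.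
  - exact: is_lim_seq_const.
  - rewrite -[X in is_lim_seq _ X](_ : Finite (0 * / (1 - q)) = _); last by congr Finite; lra.
    apply: is_lim_seq_mult'; last exact: is_lim_seq_const.
    exact: (is_lim_seq_incr_1 (fun N => INR N * q ^ N) 0).1 (is_lim_seq_INR_mult_pow q q01).
rewrite -[l](Rminus_0_r l).
apply: (is_lim_seq_ext _ _ (Finite _) _ (is_lim_seq_minus' _ _ l 0 suml lim_tail)).
move=> N; rewrite /sum_n !(sum_n_m_S (fun n => _ / (1 - q ^ n))).
rewrite (sum_n_m_S (fun k => INR (num_divisors k) * q ^ k)).
by rewrite lambert_partial_sum.
Qed.

(** * The function phi and its primitive *)

Definition planck (t x : R) : R := / (exp (x * t) - 1).
(** The primitive that vanishes at infinity; at x = 1 it is - ln (1 - q) / ln q for q = exp (-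
    t). *)
Definition planck_primitive (t x : R) : R := ln (1 - exp (- (x * t))) / t.

Lemma exp_gt_1 (x : R) : 0 < x -> 1 < exp x.
Proof. by move=> x0; rewrite -exp_0; apply: exp_increasing. Qed.

Lemma is_derive_planck_primitive (t x : R) : 0 < t -> 0 < x ->
  is_derive (planck_primitive t) x (planck t x).
Proof.
move=> t0 x0; have e1 := exp_gt_1 (x * t) (Rmult_lt_0_compat _ _ x0 t0).
have i1 : / exp (x * t) < 1 by rewrite -Rinv_1; apply: Rinv_lt_contravar; lra.
rewrite /planck_primitive /planck; auto_derive; rewrite exp_Ropp; first lra.
field; split; [|split]; lra.
Qed.

Lemma is_lim_seq_planck_primitive (t : R) : 0 < t ->
  is_lim_seq (fun n => planck_primitive t (INR (S n))) 0.
Proof.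
move=> t0; rewrite /planck_primitive.
rewrite -[X in is_lim_seq _ X](_ : Finite (ln (1 - 0) * / t) = _); last first.
  by rewrite Rminus_0_r ln_1 Rmult_0_l.
apply: is_lim_seq_mult'; last exact: is_lim_seq_const.
apply: (is_lim_seq_continuous ln).
  by apply: derivable_continuous_pt; exists (/ (1 - 0)); apply: derivable_pt_lim_ln; lra.
apply: is_lim_seq_minus'; first exact: is_lim_seq_const.
apply: (is_lim_seq_ext (fun n => exp (- t) ^ S n)).
  move=> n; rewrite -Rpower_pow; last exact: exp_pos.
  by rewrite /Rpower ln_exp; congr exp; ring.
apply: (is_lim_seq_incr_1 (fun n => exp (- t) ^ n) 0).1.
apply: is_lim_seq_geom; rewrite Rabs_pos_eq; last exact/Rlt_le/exp_pos.
by rewrite -exp_0; apply: exp_increasing; lra.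
Qed.

Lemma planck_decreasing (t x y : R) : 0 < t -> 0 < x < y -> planck t y < planck t x.
Proof.
move=> t0 xy; have e1 := exp_gt_1 (x * t) ltac:(nra).
have e2 : exp (x * t) < exp (y * t) by apply: exp_increasing; nra.
by apply: Rinv_lt_contravar; nra.
Qed.

Lemma strictly_decreasing_of_derive (f df : R -> R) (a b : R) :
  a < b -> (forall c, a <= c <= b -> is_derive f c (df c)) ->
  (forall c, a < c < b -> df c < 0) -> f b < f a.
Proof.
move=> ab fd neg.
have [||c [eq [ac cb]]] := MVT_cor2 f df a b => //.
  by move=> c cx; apply/is_derive_Reals/fd.
have := neg c (conj ac cb); nra.
Qed.

(** Up to a positive factor the derivative is -(u (e^u + 1) - (e^u - 1)). Multiplying e^(-u) > 1 - u
    by e^u gives e^u - 1 < u e^u, so it is negative. *)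
Lemma mult_exp_div_sqr_decreasing (u v : R) : 0 < u < v ->
  v * exp v / (exp v - 1) ^ 2 < u * exp u / (exp u - 1) ^ 2.
Proof.
move=> uv.
apply: (strictly_decreasing_of_derive (fun u => u * exp u / (exp u - 1) ^ 2)
  (fun u => - (exp u * (u * (exp u + 1) - (exp u - 1)) / (exp u - 1) ^ 3))); first lra.
  move=> c uc; have e1 := exp_gt_1 c ltac:(lra).
  auto_derive; first by have := pow_lt (exp c - 1) 2; simpl; lra.
  by field; lra.
move=> c uc; have e1 := exp_gt_1 c ltac:(lra).
apply: Ropp_lt_gt_0_contravar; apply: Rdiv_lt_0_compat; last by apply: pow_lt; lra.
apply: Rmult_lt_0_compat; first lra.
(* [exp (- c) >= 1 - c] *)
have := exp_ineq1 (- c) ltac:(lra); rewrite exp_Ropp => ineq.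
have inv : / exp c * exp c = 1 by field; lra.
nra.
Qed.

(** With g(u) = u e^u / (e^u - 1)^2, the derivative of [planck r] at c is - g(c r) / c. That of the
    difference is thus (g(c t) - g(c s)) / c, negative since g decreases. *)
Lemma planck_diff_decreasing (s t x y : R) : 0 < s < t -> 0 < x < y ->
  planck s y - planck t y < planck s x - planck t x.
Proof.
move=> st xy.
have dplanck r c : 0 < r -> 0 < c ->
    is_derive (planck r) c (- (c * r * exp (c * r) / (exp (c * r) - 1) ^ 2) / c).
  move=> r0 c0; have e1 := exp_gt_1 (c * r) ltac:(nra).
  by rewrite /planck; auto_derive; [lra | field; lra].
apply: (strictly_decreasing_of_derive (fun z => planck s z - planck t z)
  (fun c => - (c * s * exp (c * s) / (exp (c * s) - 1) ^ 2) / c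
            - - (c * t * exp (c * t) / (exp (c * t) - 1) ^ 2) / c)); first lra.
  by move=> c xc; apply: (is_derive_minus (planck s) (planck t)); apply: dplanck; lra.
move=> c xc.
have := mult_exp_div_sqr_decreasing (c * s) (c * t) ltac:(nra).
have := Rinv_0_lt_compat c ltac:(lra).
rewrite ![_ / c]/Rdiv; nra.
Qed.

Lemma is_series_planck (t : R) : 0 < t ->
  is_series (fun n => planck t (INR (S n))) (T (exp (- t))).
Proof.
move=> t0.
have q1 : exp (- t) < 1 by rewrite -exp_0; apply: exp_increasing; lra.
apply: is_series_ext (is_series_lambert (exp (- t)) (conj (exp_pos _) q1)) => n.
have e1 := exp_gt_1 (INR (S n) * t) (Rmult_lt_0_compat _ _ (lt_0_INR _ (Nat.lt_0_succ n)) t0).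
rewrite -Rpower_pow; last exact: exp_pos.
rewrite /Rpower ln_exp Ropp_mult_distr_r_reverse exp_Ropp /planck; rewrite -[_ = _]/(@eq R _ _); field; lra.
Qed.

(** * Positivity and monotonicity of [H] *)

Lemma H_exp (t : R) : 0 < t -> H (exp (- t)) = T (exp (- t)) + planck_primitive t 1.
Proof. by move=> t0; rewrite /H /planck_primitive ln_exp Rmult_1_l; field; lra. Qed.

Lemma H_exp_pos (t : R) : 0 < t -> 0 < H (exp (- t)).
Proof.
move=> t0; rewrite H_exp //; apply: (series_gt_primitive (planck t)).
- by move=> x x1; apply: is_derive_planck_primitive => //; lra.
- by move=> x y xy; apply: planck_decreasing => //; lra.
- exact: is_lim_seq_planck_primitive.
- exact: is_series_planck.
Qed.

Lemma H_exp_decreasing (s t : R) : 0 < s < t -> H (exp (- t)) < H (exp (- s)).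
Proof.
move=> st; have [s0 t0] : 0 < s /\ 0 < t by lra.
rewrite !H_exp //.
(* The difference of the two values of [H] is itself a series minus an integral, for the difference
   of the two functions phi. *)
suff : 0 < T (exp (- s)) - T (exp (- t)) + (planck_primitive s 1 - planck_primitive t 1).
  by lra.
apply: (series_gt_primitive (fun x => planck s x - planck t x)
  (fun x => planck_primitive s x - planck_primitive t x)).
- move=> x x1; apply: (is_derive_minus (planck_primitive s) (planck_primitive t));
    apply: is_derive_planck_primitive; lra.
- by move=> x y xy; apply: planck_diff_decreasing => //; lra.
- rewrite -[0](Rminus_0_r 0).
  by apply: is_lim_seq_minus'; apply: is_lim_seq_planck_primitive.
- exact: is_series_minus (is_series_planck s s0) (is_series_planck t t0).
Qed.

Theorem theorem3p1 :
  (forall q : R, 0 < q < 1 -> 0 < H q) /\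
  (forall q1 q2 : R, 0 < q1 < 1 -> 0 < q2 < 1 -> q1 < q2 -> H q1 < H q2).
Proof.
have qE q : 0 < q < 1 -> 0 < - ln q /\ q = exp (- - ln q).
  move=> q01; rewrite Ropp_involutive exp_ln; last lra.
  by split=> //; have := ln_increasing q 1; rewrite ln_1; lra.
split=> [q /qE[t0 ->]|q1 q2 q1_01 q2_01 lt12]; first exact: H_exp_pos.
have [t1 ->] := qE q1 q1_01; have [t2 ->] := qE q2 q2_01.
apply: H_exp_decreasing; have := ln_increasing q1 q2; lra.
Qed.
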